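(* (a) Let $G_1$ and $G_2$ be $Q$-cospectral regular graphs and let $H$ be any regular graph. Then $H\odot G_1$ and $H\odot G_2$ are $Q$-cospectral. (b) Let $G_1$ and $G_2$ be $Q$-cospectral regular graphs and let $H$ be any regular graph. Then $G_1\odot H$ and $G_2\odot H$ are $Q$-cospectral. (c) Let $G_1$ and $G_2$ be $Q$-cospectral regular graphs, and let $H_1$ and $H_2$ be another pair of $Q$-cospectral regular graphs. Then $G_1\odot H_1$ and $G_2\odot H_2$ are $Q$-cospectral.
   Context: All graphs are finite, simple and connected. $Q(G)=D(G)+A(G)$ is the signless Laplacian matrix of $G$, where $A(G)$ is the adjacency matrix and $D(G)$ the diagonal matrix of vertex degrees. Two non-isomorphic graphs are called $Q$-cospectral if their signless Laplacian matrices have the same eigenvalues with the same multiplicities. The central graph $C(G)$ of $G$ is obtained from $G$ by subdividing each edge of $G$ exactly once and joining all pairs of distinct vertices of $G$ that are nonadjacent in $G$. For graphs $G,G'$, the central vertex corona $G\odot G'$ is obtained by taking one copy of $C(G)$ and $|V(G)|$ copies of $G'$, and joining the $i$-th vertex $v_i$ of $G$ (viewed in $C(G)$) to every vertex in the $i$-th copy of $G'$, for each $i$. *)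

(* Defs.v *)
From mathcomp Require Import all_boot all_order all_algebra.

Set Implicit Arguments.
Unset Strict Implicit.
Unset Printing Implicit Defensive.

Import GRing.Theory Num.Theory.
Local Open Scope ring_scope.

Record sgraph := SGraph {
  vertex :> finType;
  adj : rel vertex;
  adj_sym : symmetric adj;
  adj_irr : irreflexive adj
}.

(* The null graph is not connected. *)
Definition connected_graph (G : sgraph) : Prop :=
  (0 < #|G|)%N /\ forall x y : G, connect (@adj G) x y.

Definition degree (G : sgraph) (x : G) : nat := #|[set y | adj x y]|.

Definition regular_graph (G : sgraph) : Prop :=
  exists r : nat, forall x : G, degree x = r.

Definition isomorphic (G H : sgraph) : Prop :=
  exists f : G -> H, bijective f /\ forall x y, adj (f x) (f y) = adj x y.

Section SignlessLaplacian.
Variables (C : numClosedFieldType) (G : sgraph).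

Definition adjacency_mx : 'M[C]_#|G| :=
  \matrix_(i, j) (adj (enum_val i) (enum_val j))%:R.

Definition degree_mx : 'M[C]_#|G| :=
  diag_mx (\row_i (degree (enum_val i))%:R).

Definition signless_laplacian : 'M[C]_#|G| := degree_mx + adjacency_mx.

(* Multiplicity of a as a root of the characteristic polynomial; it is 0
   exactly when a is not an eigenvalue. *)
Definition Q_multiplicity (a : C) : nat :=
  mup a (char_poly signless_laplacian).

End SignlessLaplacian.

Definition Q_cospectral (C : numClosedFieldType) (G H : sgraph) : Prop :=
  ~ isomorphic G H /\
  forall a : C, Q_multiplicity G a = Q_multiplicity H a.

Definition edges (G : sgraph) : {set {set G}} :=
  [set [set p.1; p.2] | p : G * G & adj p.1 p.2].

Definition edge (G : sgraph) : finType := {e : {set G} | e \in edges G}.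

(* inl x is the original vertex x, inr e the vertex subdividing the edge e. *)
Definition central_adj (G : sgraph) : rel (G + edge G) :=
  fun u v =>
    match u, v with
    | inl x, inl y => (x != y) && ~~ adj x y
    | inl x, inr e => x \in val e
    | inr e, inl x => x \in val e
    | inr _, inr _ => false
    end.

Lemma central_adj_sym G : symmetric (@central_adj G).
Proof. by move=> [x|e] [y|f] //=; rewrite eq_sym adj_sym. Qed.

Lemma central_adj_irr G : irreflexive (@central_adj G).
Proof. by move=> [x|e] //=; rewrite eqxx. Qed.

Definition central_graph (G : sgraph) : sgraph :=
  SGraph (@central_adj_sym G) (@central_adj_irr G).

(* inr (x, a) is the vertex a in the copy of H attached to the vertex x of G. *)
Definition corona_adj (G H : sgraph) : rel (central_graph G + G * H) :=
  fun u v =>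
    match u, v with
    | inl s, inl t => adj s t
    | inl s, inr (y, _) => s == inl y
    | inr (x, _), inl t => t == inl x
    | inr (x, a), inr (y, b) => (x == y) && adj a b
    end.

Lemma corona_adj_sym G H : symmetric (@corona_adj G H).
Proof.
move=> [s|[x a]] [t|[y b]] //=; first exact: central_adj_sym.
by rewrite eq_sym adj_sym.
Qed.

Lemma corona_adj_irr G H : irreflexive (@corona_adj G H).
Proof.
move=> [s|[x a]] /=; first exact: central_adj_irr.
by rewrite eqxx adj_irr.
Qed.

Definition central_vertex_corona (G H : sgraph) : sgraph :=
  SGraph (@corona_adj_sym G H) (@corona_adj_irr G H).

(* Coronas stay within the class of connected graphs. *)
Lemma central_vertex_corona_connected G H :
  connected_graph G -> connected_graph (central_vertex_corona G H).
Proof.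
move=> [/card_gt0P[x0 _] conG]; split.
  by apply/card_gt0P; exists (inl (inl x0)).
have csym := sym_connect_sym (@corona_adj_sym G H).
pose v x : central_vertex_corona G H := inl (inl x).
have vE (x y : G) : adj x y -> connect (@corona_adj G H) (v x) (v y).
  move=> xy.
  have eP : [set x; y] \in edges G by apply/imsetP; exists (x, y); rewrite ?inE.
  pose e : edge G := Sub [set x; y] eP.
  apply: (@connect_trans _ _ (inl (inr e))); apply: connect1 => /=.
    by rewrite !inE eqxx.
  by rewrite !inE eqxx orbT.
have vC (x y : G) : connect (@corona_adj G H) (v x) (v y).
  have /connectP[p pP ->] := conG x y.
  elim: p x pP => [|z p IHp] x /=; first by move=> _; apply: connect0.
  by case/andP=> /vE xz /IHp; apply: connect_trans.
suff toV u : exists x, connect (@corona_adj G H) u (v x).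
  move=> u w; have [x ux] := toV u; have [y wy] := toV w.
  apply: connect_trans ux (connect_trans (vC x y) _).
  by rewrite csym.
case: u => [[x|e]|[x a]]; first by exists x; rewrite connect0.
  have /imsetP[[x y] _ eE] := valP e.
  by exists x; apply: connect1; rewrite /= eE !inE eqxx.
by exists x; apply: connect1 => /=.
Qed.

(* Main.v *)
Require Import Defs.
From mathcomp Require Import all_boot all_order all_algebra.
From mathcomp Require Import zify ring.

Set Implicit Arguments.
Unset Strict Implicit.
Unset Printing Implicit Defensive.

Import GRing.Theory Num.Theory.
Local Open Scope ring_scope.

(** Write [n] and [r] for the order and degree of the base graph [G], [k] and
    [s] for those of the graph [H] that is copied, and [K] for the corona of [G]
    and [H]. There are two independent claims.

    Equal spectra. In the determinant of [z - Q(K)] the copies of [H] can be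
    eliminated, because the all-ones vector of each copy is an eigenvector of
    [Q(H)]; then the vertices subdividing the edges of [G] can be eliminated,
    because their block is scalar and the incidence matrix [B] of [G] satisfies
    [B B^T = Q(G)]. What is left on the vertices of [G] is [a + b Q(G) - J] with
    [J] the all-ones matrix and [a], [b] rational in [z], and its determinant
    factors since [Q(G)] has constant row sums [2 r] ([det_sub_ones]). So the
    characteristic polynomial of [K] depends only on [n], [r], [k], [s], the
    number [n r / 2] of edges of [G], and the characteristic polynomials of
    [Q(G)] and [Q(H)] ([char_poly_corona], [char_poly_corona_eq]). For regular
    graphs the latter determine order and degree ([cospectral_regular]). The
    computation is done at each scalar [z] outside the zeros of an explicit
    nonzero polynomial, which suffices for an identity between polynomials.

    Non-isomorphism. In [K] the vertices of [G] have degree [n - 1 + k], the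
    subdivision vertices degree 2 and the vertices of the copies degree [s + 1].
    Two connected regular graphs of the same order and degree that are not
    isomorphic have at least three vertices and are not complete
    ([noniso_regular]); when this holds for the base graphs or for the copied
    graphs, the first degree differs from the other two. An isomorphism of
    coronas then maps base vertices to base vertices, hence copies to copies,
    and induces isomorphisms of the base graphs and of the copied graphs
    ([corona_isomorphic]). *)

(** * Degrees and incidences *)

Lemma card_sum_nat (T : finType) (P : pred T) :
  #|[set x | P x]| = (\sum_x P x)%N.
Proof.
rewrite -sum1_card big_mkcond; apply: eq_bigr => x _.
by rewrite inE; case: (P x).
Qed.

Lemma degreeE (G : sgraph) (x : G) : degree x = (\sum_y adj x y)%N.
Proof. exact: card_sum_nat. Qed.

Lemma degree_lt_order (G : sgraph) (x : G) : (degree x < #|G|)%N.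
Proof.
rewrite -cardsT; apply: proper_card; rewrite properT; apply/eqP => /setP/(_ x).
by rewrite !inE adj_irr.
Qed.

Lemma edge_endpoints (G : sgraph) (e : edge G) :
  exists x y, [/\ adj x y, x != y & val e = [set x; y]].
Proof.
have /imsetP[[x y] xy ->] := valP e; rewrite inE /= in xy.
exists x, y; split=> //; apply/negP => /eqP yE.
by rewrite yE adj_irr in xy.
Qed.

(** The number of edges satisfying [P], as sets of vertices. *)
Lemma sum_edge (G : sgraph) (P : pred {set G}) :
  (\sum_(e : edge G) P (val e) = #|[set e in edges G | P e]|)%N.
Proof.
rewrite -(@big_sub _ _ _ _ (fun e => e \in edges G) (fun e => P e : nat)) -sum1_card.
rewrite big_mkcond [RHS]big_mkcond.
by apply: eq_bigr => e _; rewrite inE; case: (e \in _); case: (P e).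
Qed.

Lemma sum_incident_edges (G : sgraph) (x : G) :
  (\sum_(e : edge G) (x \in val e) = degree x)%N.
Proof.
rewrite (sum_edge (fun e => x \in e)) /degree.
have -> : [set e in edges G | x \in e] =
    [set [set x; z] | z in [set y | adj x y]].
  apply/setP => e; rewrite inE; apply/andP/imsetP => [[/imsetP[[a b] ab ->]]|[z]].
    rewrite inE /= in ab; rewrite !inE => /orP[]/eqP->; first by exists b; rewrite ?inE.
    by exists a; rewrite ?inE 1?adj_sym // setUC.
  rewrite inE => xz ->; split; last by rewrite !inE eqxx.
  by apply/imsetP; exists (x, z); rewrite ?inE.
apply: card_in_imset => a b; rewrite !inE => xa xb /setP/(_ a).
rewrite !inE eqxx orbT; case: eqP => [aE|_ /esym/eqP //].
by rewrite aE adj_irr in xa.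
Qed.

Lemma sum_common_edges (G : sgraph) (x y : G) : x != y ->
  (\sum_(e : edge G) ((x \in val e) && (y \in val e)) = adj x y)%N.
Proof.
move=> xy; rewrite (sum_edge (fun e => (x \in e) && (y \in e))).
case xyA: (adj x y).
  apply/eqP/cards1P; exists [set x; y]; apply/setP => e; rewrite !inE.
  apply/andP/eqP => [[/imsetP[[a b] _ ->]]|->]; last first.
    rewrite !inE !eqxx orbT; split=> //.
    by apply/imsetP; exists (x, y); rewrite ?inE.
  rewrite !inE /= => /andP[/orP[]/eqP xE /orP[]/eqP yE];
    by move: xy; rewrite xE yE ?eqxx // setUC.
apply/eqP; rewrite cards_eq0; apply/eqP/setP => e; rewrite !inE.
apply/negP => /andP[/imsetP[[a b] ab ->]]; rewrite inE /= in ab.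
rewrite !inE /= => /andP[/orP[]/eqP xE /orP[]/eqP yE]; subst; rewrite ?eqxx // in xy.
  by rewrite ab in xyA.
by rewrite adj_sym ab in xyA.
Qed.

Lemma sum_edge_endpoints (G : sgraph) (e : edge G) : (\sum_x (x \in val e) = 2)%N.
Proof.
have [x [y [_ xy ->]]] := edge_endpoints e.
rewrite -card_sum_nat.
suff -> : [set z | z \in [set x; y]] = [set x; y] by rewrite cards2 xy.
by apply/setP => z; rewrite inE.
Qed.

Lemma handshake (G : sgraph) : (\sum_(x : G) degree x = 2 * #|edge G|)%N.
Proof.
under eq_bigr => x _ do rewrite -sum_incident_edges.
rewrite exchange_big /=.
under eq_bigr => e _ do rewrite sum_edge_endpoints.
by rewrite sum_nat_const mulnC.
Qed.

Lemma sum_eq1 (T : finType) (x : T) : (\sum_y (x == y) = 1)%N.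
Proof. by rewrite (bigD1 x) //= eqxx big1 // => y; rewrite eq_sym => /negbTE->. Qed.

Section CoronaDegrees.
Variables G H : sgraph.
Notation K := (central_vertex_corona G H).

Lemma corona_degreeE (u : K) :
  degree u = (\sum_x adj u (inl (inl x)) + \sum_e adj u (inl (inr e)) +
              \sum_x \sum_a adj u (inr (x, a)))%N.
Proof.
rewrite degreeE big_sumType /= (big_sumType _ _ (fun i => adj u (inl i) : nat)) /=.
by congr (_ + _)%N; rewrite pair_big; apply: eq_bigr => -[x a].
Qed.

Lemma degree_base (x : G) :
  degree (inl (inl x) : K) = (#|G| - 1 + #|H|)%N.
Proof.
rewrite corona_degreeE /= sum_incident_edges; congr (_ + _)%N.
  rewrite degreeE -big_split /=.
  rewrite -(sum_eq1 x) -sum1_card -sumnB.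
    apply: eq_bigr => y _; case: eqP => [->|_] /=; first by rewrite adj_irr.
    by case: (adj x y).
  by move=> y _; case: eqP.
transitivity (\sum_y (x == y) * #|H|)%N.
  apply: eq_bigr => y _; transitivity (\sum_(a : H) (x == y))%N => //.
  by rewrite sum_nat_const mulnC.
by rewrite -big_distrl /= sum_eq1 mul1n.
Qed.

Lemma degree_subdivision (e : edge G) : degree (inl (inr e) : K) = 2.
Proof.
rewrite corona_degreeE /= sum_edge_endpoints big1 // big1 // => x _.
by rewrite big1.
Qed.

Lemma degree_copy (x : G) (a : H) :
  degree (inr (x, a) : K) = (degree a).+1.
Proof.
rewrite corona_degreeE /= [X in (_ + X + _)%N]big1 // addn0.
rewrite (eq_bigr (fun y => (x == y) : nat)); last by move=> y _; rewrite eq_sym.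
rewrite sum_eq1 add1n; congr _.+1.
rewrite (bigD1 x) //= [X in (_ + X)%N]big1 ?addn0.
  by rewrite degreeE; apply: eq_bigr => b _; rewrite eqxx.
by move=> y; rewrite eq_sym => /negbTE->; rewrite big1.
Qed.

End CoronaDegrees.

(** * Isomorphisms between coronas *)

Lemma isomorphic_of_inj (G H : sgraph) (f : G -> H) :
    injective f -> #|G| = #|H| -> (forall x y, adj (f x) (f y) = adj x y) ->
  isomorphic G H.
Proof. by move=> fI GH fA; exists f; split=> //; apply: inj_card_bij; rewrite ?GH. Qed.

Lemma degree_iso (G H : sgraph) (f : G -> H) x :
  bijective f -> (forall x y, adj (f x) (f y) = adj x y) -> degree (f x) = degree x.
Proof.
move=> fB fA; rewrite !degreeE (reindex f) /=; last exact: onW_bij.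
by apply: eq_bigr => y _; rewrite fA.
Qed.

Lemma complete_of_degree (G : sgraph) r :
    (forall x : G, degree x = r) -> (#|G| <= r.+1)%N ->
  forall x y : G, adj x y = (x != y).
Proof.
move=> deg_r le_G x y.
have sub : [set y | adj x y] \subset [set~ x].
  apply/subsetP => z; rewrite !inE => xz; apply/eqP => zx.
  by rewrite zx adj_irr in xz.
have : [set y | adj x y] == [set~ x].
  rewrite eqEcard sub cardsC1 -/(degree x) deg_r.
  by case: #|G| le_G => //= n; rewrite ltnS.
by move/eqP/setP/(_ y); rewrite !inE eq_sym.
Qed.

Lemma regular_degree_gt0 (G : sgraph) r :
  connected_graph G -> (forall x : G, degree x = r) -> (1 < #|G|)%N -> (0 < r)%N.
Proof.
move=> [_ conn] deg_r /card_gt1P[x [y [_ _ xy]]].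
have /connectP[[|z p] /= pP yE] := conn x y; first by rewrite yE eqxx in xy.
rewrite -(deg_r x) /degree card_gt0; apply/set0Pn; exists z; rewrite inE.
by case/andP: pP.
Qed.

(** Complete graphs of the same order are isomorphic, and a connected graph
    with at most two vertices is complete. *)
Lemma noniso_regular (G H : sgraph) r :
    connected_graph G -> #|G| = #|H| ->
    (forall x : G, degree x = r) -> (forall x : H, degree x = r) ->
    ~ isomorphic G H -> (2 < #|G|)%N /\ (r.+1 < #|G|)%N.
Proof.
move=> cG GH dG dH nI.
have lt_r : (r.+1 < #|G|)%N.
  rewrite ltnNge; apply/negP => le_G; apply: nI.
  pose f (x : G) : H := enum_val (cast_ord GH (enum_rank x)).
  have fI : injective f by move=> x y /enum_val_inj/cast_ord_inj/enum_rank_inj.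
  apply: (isomorphic_of_inj fI GH) => x y.
  rewrite (complete_of_degree dH) -?GH // (complete_of_degree dG) //.
  by rewrite (inj_eq fI).
split=> //; case: (ltngtP 2 #|G|) => // G2; last first.
  by have := regular_degree_gt0 cG dG; lia.
by lia.
Qed.

(** Membership in the vertex set of [G], inside the corona of [G] and [H]. *)
Definition is_base (G H : sgraph) (u : central_vertex_corona G H) : bool :=
  if u is inl (inl _) then true else false.

Section CoronaIsomorphism.
Variables G1 G2 H1 H2 : sgraph.
Notation K1 := (central_vertex_corona G1 H1).
Notation K2 := (central_vertex_corona G2 H2).
Variable f : K1 -> K2.
Hypothesis f_bij : bijective f.
Hypothesis f_adj : forall u v, adj (f u) (f v) = adj u v.
Hypothesis f_base : forall u, is_base (f u) = is_base u.
Hypothesis G12 : #|G1| = #|G2|.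
Hypothesis H12 : #|H1| = #|H2|.

Let f_inj : injective f := bij_inj f_bij.

Lemma base_iso_exists :
  {h : G1 -> G2 | forall x, f (inl (inl x)) = inl (inl (h x))}.
Proof.
have fx x : {y | f (inl (inl x)) = inl (inl y)}.
  by case: (f _) (f_base (inl (inl x))) => [[y|?]|?] // _; exists y.
by exists (fun x => sval (fx x)) => x; case: (fx x).
Qed.

Let h := sval base_iso_exists.
Let hE x : f (inl (inl x)) = inl (inl (h x)) := svalP base_iso_exists x.

Let h_inj : injective h.
Proof. by move=> x y hxy; have := hE x; rewrite hxy -hE => /f_inj[]. Qed.

Lemma corona_iso_base : isomorphic G1 G2.
Proof.
apply: (isomorphic_of_inj h_inj G12) => x y.
have [->|xy] := eqVneq x y; first by rewrite !adj_irr.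
have := f_adj (inl (inl x)) (inl (inl y)); rewrite !hE /= (inj_eq h_inj) xy /=.
exact: negb_inj.
Qed.

(** A vertex in a copy has a single base neighbour, a subdivision vertex has
    two, so copies are mapped to copies. *)
Lemma corona_iso_copy x a : {b | f (inr (x, a)) = inr (h x, b)}.
Proof.
have fA y : adj (f (inr (x, a))) (inl (inl (h y))) = (y == x).
  by rewrite -hE f_adj.
case: (f _) (f_base (inr (x, a))) fA => [[y|e]|[y b]] //= _ fA.
- exfalso; have [h' _ h'K] := inj_card_bij h_inj (eq_leq (esym G12)).
  have [y [z [_ yz eE]]] := edge_endpoints e.
  have /eqP yE : h' y == x by rewrite -fA /= h'K eE !inE eqxx.
  have /eqP zE : h' z == x by rewrite -fA /= h'K eE !inE eqxx orbT.
  by rewrite -(h'K y) -(h'K z) yE zE eqxx in yz.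
- by exists b; have := fA x; rewrite eqxx => /eqP[->].
Qed.

Lemma corona_iso_fibre : (0 < #|G1|)%N -> isomorphic H1 H2.
Proof.
move=> /card_gt0P[x _]; pose g a := sval (corona_iso_copy x a).
have gE a : f (inr (x, a)) = inr (h x, g a) := svalP (corona_iso_copy x a).
have gI : injective g by move=> a b gab; have := gE a; rewrite gab -gE => /f_inj[].
apply: (isomorphic_of_inj gI H12) => a b.
by have := f_adj (inr (x, a)) (inr (x, b)); rewrite !gE /= !eqxx.
Qed.

End CoronaIsomorphism.

(** Base vertices of a corona have degree #|G| - 1 + #|H|, the others degree 2
    or s + 1, so the hypotheses make every isomorphism preserve them. *)
Lemma corona_isomorphic (G1 G2 H1 H2 : sgraph) s :
    (0 < #|G1|)%N -> #|G1| = #|G2| -> #|H1| = #|H2| ->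
    (forall a : H1, degree a = s) -> (forall a : H2, degree a = s) ->
    (#|G1| - 1 + #|H1| != 2)%N -> (#|G1| - 1 + #|H1| != s.+1)%N ->
    isomorphic (central_vertex_corona G1 H1) (central_vertex_corona G2 H2) ->
  isomorphic G1 G2 /\ isomorphic H1 H2.
Proof.
move=> G1_gt0 G12 H12 dH1 dH2 n2 ns [f [fB fA]].
pose d := (#|G1| - 1 + #|H1|)%N.
have base1 (u : central_vertex_corona G1 H1) : is_base u = (degree u == d).
  case: u => [[x|e]|[x a]]; rewrite ?degree_base ?degree_subdivision ?degree_copy /=.
  - by rewrite eqxx.
  - by rewrite eq_sym (negbTE n2).
  - by rewrite dH1 eq_sym (negbTE ns).
have base2 (u : central_vertex_corona G2 H2) : is_base u = (degree u == d).
  rewrite /d G12 H12 in n2 ns *.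
  case: u => [[x|e]|[x a]]; rewrite ?degree_base ?degree_subdivision ?degree_copy /=.
  - by rewrite eqxx.
  - by rewrite eq_sym (negbTE n2).
  - by rewrite dH2 eq_sym (negbTE ns).
have fbase u : is_base (f u) = is_base u by rewrite base1 base2 degree_iso.
split; first exact: corona_iso_base fB fA fbase G12.
exact: corona_iso_fibre fB fA fbase G12 H12 G1_gt0.
Qed.

(** * Determinants indexed by finite types *)

Section FinTypeDeterminant.
Variable R : comNzRingType.
Implicit Types S T U : finType.

(** The determinant of a square matrix whose rows and columns are indexed by
    the finite type [T]. *)
Definition detf T (M : T -> T -> R) : R :=
  \det (\matrix_(i < #|T|, j < #|T|) M (enum_val i) (enum_val j)).

Lemma eq_detf T (M N : T -> T -> R) : M =2 N -> detf M = detf N.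
Proof. by move=> MN; congr (\det _); apply/matrixP => i j; rewrite !mxE MN. Qed.

Lemma det_reindex n T (f : 'I_n -> T) (M : T -> T -> R) :
  bijective f -> \det (\matrix_(i, j) M (f i) (f j)) = detf M.
Proof.
move=> fB; have := bij_eq_card fB; rewrite card_ord => nT; subst n.
have sI : injective (fun i => enum_rank (f i)).
  by move=> i j /enum_rank_inj/(bij_inj fB).
pose s := perm.perm sI.
have -> : \matrix_(i, j) M (f i) (f j) =
    row_perm s (col_perm s (\matrix_(i < #|T|, j < #|T|) M (enum_val i) (enum_val j))).
  by apply/matrixP => i j; rewrite !mxE !perm.permE !enum_rankK.
rewrite row_permE col_permE !det_mulmx !det_perm perm.odd_permV.
by rewrite mulrCA -signr_addb addbb mulr1.
Qed.

Lemma detf_bij S T (f : S -> T) (M : T -> T -> R) :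
  bijective f -> detf (fun u v => M (f u) (f v)) = detf M.
Proof.
move=> fB; rewrite -(@det_reindex #|S| T (fun i => f (enum_val i)) M) //.
exact: bij_comp fB (enum_val_bij _).
Qed.

(** Block elimination: when [X] solves the linear system whose matrix is the
    lower right block and whose right-hand side is the lower left block,
    subtracting the right block columns times [X] from the left ones makes the
    matrix block triangular. No block needs to be invertible. *)
Lemma detf_schur S T (M : S + T -> S + T -> R) (X : T -> S -> R) :
    (forall u x, \sum_v M (inr u) (inr v) * X v x = M (inr u) (inl x)) ->
  detf M = detf (fun u v => M (inr u) (inr v)) *
           detf (fun x y => M (inl x) (inl y) - \sum_v M (inl x) (inr v) * X v y).
Proof.
move=> MX; pose f (i : 'I_(#|S| + #|T|)) : S + T :=
  match split i with inl i => inl (enum_val i) | inr i => inr (enum_val i) end.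
pose g (u : S + T) : 'I_(#|S| + #|T|) :=
  match u with inl x => lshift _ (enum_rank x) | inr x => rshift _ (enum_rank x) end.
have fB : bijective f.
  exists g => [i|[x|x]]; rewrite /f /g.
  - by case: splitP => j jE; apply/val_inj; rewrite /= enum_valK jE.
  - by rewrite (unsplitK (inl _)) enum_rankK.
  - by rewrite (unsplitK (inr _)) enum_rankK.
rewrite -(det_reindex M fB) /detf.
set D := \matrix_(i < #|T|, j < #|T|) M (inr (enum_val i)) (inr (enum_val j)).
set A := (X in _ * \det X).
pose B := \matrix_(i < #|S|, j < #|T|) M (inl (enum_val i)) (inr (enum_val j)).
pose B' := \matrix_(i < #|T|, j < #|S|) M (inr (enum_val i)) (inl (enum_val j)).
pose A' := \matrix_(i < #|S|, j < #|S|) M (inl (enum_val i)) (inl (enum_val j)).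
pose Y := \matrix_(i < #|T|, j < #|S|) X (enum_val i) (enum_val j).
have -> : \matrix_(i, j) M (f i) (f j) = block_mx A' B B' D.
  by apply/matrixP => i j; rewrite !mxE /f; case: split => i';
    rewrite !mxE; case: split => j'; rewrite !mxE.
have DY : D *m Y = B'.
  apply/matrixP => i j; rewrite !mxE -MX (reindex (fun k : 'I_#|T| => enum_val k)) /=.
    by apply: eq_bigr => k _; rewrite !mxE.
  exact/onW_bij/enum_val_bij.
have BY : A' - B *m Y = A.
  apply/matrixP => i j; rewrite !mxE; congr (_ - _).
  rewrite [RHS](reindex (fun k : 'I_#|T| => enum_val k)) /=;
    last exact/onW_bij/enum_val_bij.
  by apply: eq_bigr => k _; rewrite !mxE.
have <- : \det (block_mx A' B B' D *m block_mx 1%:M 0 (- Y) 1%:M) = \det D * \det A.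
  rewrite mulmx_block !mulmx1 !mulmx0 !add0r !mulmxN DY BY subrr.
  by rewrite det_ublock mulrC.
by rewrite det_mulmx det_lblock !det1 !mulr1.
Qed.

Lemma detf_card0 T (M : T -> T -> R) : #|T| = 0%N -> detf M = 1.
Proof.
rewrite /detf; move: (\matrix_(_, _) _) => A T0; move: A; rewrite T0 => A.
exact: det_mx00.
Qed.

Lemma detf_scalar T a : detf (fun x y : T => a *+ (x == y)) = a ^+ #|T|.
Proof.
rewrite -det_scalar; congr (\det _); apply/matrixP => i j.
by rewrite !mxE (inj_eq enum_val_inj).
Qed.

(** The determinant of the Kronecker product of an identity matrix and [M]. *)
Lemma detf_copies S T (M : T -> T -> R) :
  detf (fun u v : S * T => M u.2 v.2 *+ (u.1 == v.1)) = detf M ^+ #|S|.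
Proof.
pose I (n : nat) (u v : 'I_n * T) : R := M u.2 v.2 *+ (u.1 == v.1).
have detI n : detf (@I n) = detf M ^+ n.
  elim: n => [|n IHn]; first by rewrite detf_card0 // card_prod card_ord.
  pose f (u : T + 'I_n * T) : 'I_n.+1 * T :=
    match u with inl x => (ord0, x) | inr (i, x) => (lift ord0 i, x) end.
  have fB : bijective f.
    apply: inj_card_bij => [[x|[i x]] [y|[j y]] []|] //; first by move=> ->.
      by move=> ij ->; congr (inr (_, _)); apply: val_inj.
    by rewrite card_sum !card_prod !card_ord mulSn.
  rewrite -(detf_bij _ fB) (@detf_schur _ _ _ (fun _ _ => 0)); last first.
    by move=> [i x] y; rewrite big1 // => v _; rewrite mulr0.
  rewrite exprSr -IHn; congr (_ * _); apply: eq_detf.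
    by move=> [i x] [j y]; rewrite /I /= (inj_eq (@lift_inj _ _)).
  by move=> x y; rewrite big1 ?subr0 // => v _; rewrite mulr0.
rewrite -detI -(@detf_bij ('I_#|S| * T)%type _ (fun u => (enum_val u.1, u.2))).
  by apply: eq_detf => u v; rewrite /I /= (inj_eq enum_val_inj).
apply: inj_card_bij => [[i x] [j y] [/enum_val_inj -> ->] //|].
by rewrite !card_prod card_ord.
Qed.

End FinTypeDeterminant.

(** * Characteristic polynomials *)

Lemma horner_char_poly (R : comNzRingType) n (A : 'M[R]_n) z :
  (char_poly A).[z] = \det (z%:M - A).
Proof.
rewrite /char_poly -horner_evalE -det_map_mx; congr (\det _).
apply/matrixP => i j; rewrite !mxE /= horner_evalE.
by rewrite hornerD hornerN hornerMn hornerX hornerC.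
Qed.

(** Two polynomials that agree off the zeros of a nonzero polynomial are equal. *)
Lemma poly_eq_off (C : numDomainType) (p q b : {poly C}) :
  b != 0 -> (forall z, b.[z] != 0 -> p.[z] = q.[z]) -> p = q.
Proof.
move=> b0 pq; pose d := (p - q) * b.
have d0 z : root d z.
  rewrite /root hornerM; have [->|/pq E] := eqVneq b.[z] 0; first by rewrite mulr0.
  by rewrite hornerD hornerN E subrr mul0r.
have: d = 0.
  apply/eqP/negPn/negP => dN0.
  (* In characteristic 0 the naturals provide more roots than the degree. *)
  have := @max_poly_roots _ d [seq i%:R | i <- iota 0 (size d)] dN0.
  rewrite size_map size_iota ltnn => H; apply: notF; apply: H.
    by apply/allP => z _; apply: d0.
  by rewrite map_inj_uniq ?iota_uniq // => i j /eqP; rewrite eqr_nat => /eqP.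
by move/eqP; rewrite mulf_eq0 (negbTE b0) orbF subr_eq0 => /eqP.
Qed.

Lemma monic_eq_of_mup (F : closedFieldType) (p q : {poly F}) :
  p \is monic -> q \is monic -> (forall a, mup a p = mup a q) -> p = q.
Proof.
move=> /monicP p1 /monicP q1.
have [s ->] := closed_field_poly_normal p; have [t ->] := closed_field_poly_normal q.
rewrite p1 q1 !scale1r => st; apply: perm_big; apply/allP => a _ /=.
by rewrite -!mu_prod_XsubC st.
Qed.

(** For [Q] with constant row sums [t], the matrix [a + b Q - J] is a product:
    [J] is the all-ones matrix and [Q J = t J]. *)
Lemma det_sub_ones (F : fieldType) n (Q : 'M[F]_n) t a b :
    (forall i, \sum_j Q i j = t) -> b != 0 -> a + b * t != 0 ->
  \det (a%:M + b *: Q - const_mx 1) =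
  (- b) ^+ n * (char_poly Q).[- a / b] * \det (1%:M - const_mx (a + b * t)^-1 : 'M[F]_n).
Proof.
move=> Qt b0 g0; rewrite horner_char_poly -detZ.
have -> : - b *: ((- a / b)%:M - Q) = a%:M + b *: Q.
  apply/matrixP => i j; rewrite !mxE.
  by case: (i == j); rewrite /=; field.
rewrite -det_mulmx; congr (\det _).
rewrite mulmxBr mulmx1; congr (_ - _); apply/matrixP => i j; rewrite !mxE.
transitivity ((\sum_k (a%:M + b *: Q) i k) * (a + b * t)^-1).
  under eq_bigr => k _ do rewrite !mxE.
  rewrite big_split /= -mulr_sumr Qt (bigD1 i) //= eqxx big1 ?addr0 ?mulfV //.
  by move=> k; rewrite eq_sym => /negbTE->.
by rewrite mulr_suml; apply: eq_bigr => k _; rewrite !mxE.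
Qed.

(** * The signless Laplacian spectrum of a corona *)

Section SignlessEntries.
Variables (C : numClosedFieldType) (G : sgraph).

(** The signless Laplacian matrix, indexed by the vertices themselves. *)
Definition sl_entry (x y : G) : C := (degree x)%:R *+ (x == y) + (adj x y)%:R.

Lemma signless_laplacianE i j :
  signless_laplacian C G i j = sl_entry (enum_val i) (enum_val j).
Proof. by rewrite !mxE /sl_entry (inj_eq enum_val_inj). Qed.

Lemma sum_sl_entry x : \sum_y sl_entry x y = (2 * degree x)%:R.
Proof.
rewrite big_split /= -natr_sum -degreeE (bigD1 x) //= eqxx big1 ?addr0.
  by rewrite mul2n -addnn natrD.
by move=> y; rewrite eq_sym => /negbTE->.
Qed.

Lemma horner_char_poly_sl z :
  (char_poly (signless_laplacian C G)).[z] =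
  detf (fun x y : G => z *+ (x == y) - sl_entry x y).
Proof.
rewrite horner_char_poly; congr (\det _); apply/matrixP => i j.
by rewrite !mxE /sl_entry (inj_eq enum_val_inj).
Qed.

(** The incidence matrix [B] satisfies [B B^T = D + A]. *)
Lemma sum_incidence (x y : G) :
  \sum_(e : edge G) (x \in val e)%:R * (y \in val e)%:R = sl_entry x y.
Proof.
under eq_bigr => e _ do rewrite -natrM mulnb.
rewrite -natr_sum /sl_entry; have [<-|xy] := eqVneq x y.
  rewrite adj_irr addr0 -sum_incident_edges; congr (_%:R).
  by apply: eq_bigr => e _; rewrite andbb.
by rewrite sum_common_edges // add0r.
Qed.

End SignlessEntries.

Lemma sum_delta (R : nzRingType) (T : finType) (x : T) (F : T -> R) :
  \sum_y (x == y)%:R * F y = F x.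
Proof.
rewrite (bigD1 x) //= eqxx mul1r big1 ?addr0 // => y.
by rewrite eq_sym => /negbTE->; rewrite mul0r.
Qed.

Lemma sum_pairs (R : nmodType) (S T : finType) (F : S * T -> R) :
  \sum_u F u = \sum_x \sum_y F (x, y).
Proof. by rewrite pair_big; apply: eq_bigr => -[]. Qed.

(** The entries of [z - Q(K)], block by block. *)
Section CoronaEntries.
Variables (C : numClosedFieldType) (G H : sgraph) (s : nat) (z : C).
Hypothesis dH : forall a : H, degree a = s.
Notation K := (central_vertex_corona G H).
Let L (u v : K) : C := z *+ (u == v) - sl_entry C u v.

Lemma corona_entry_copy x a y b :
  L (inr (x, a)) (inr (y, b)) =
  ((z - 1) *+ (a == b) - sl_entry C a b) *+ (x == y).
Proof.
rewrite /L /sl_entry degree_copy (inj_eq (@inr_inj _ _)) xpair_eqE /= dH.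
by case: (x == y); case: (a == b); rewrite /= ?mulr0n ?mulr1n; ring.
Qed.

Lemma corona_entry_copy_l x a t : L (inr (x, a)) (inl t) = - (t == inl x)%:R.
Proof. by rewrite /L /sl_entry /= !mulr0n !add0r. Qed.

Lemma corona_entry_copy_r x a t : L (inl t) (inr (x, a)) = - (t == inl x)%:R.
Proof. by rewrite /L /sl_entry /= !mulr0n !add0r. Qed.

Lemma corona_entry_subdiv e f :
  L (inl (inr e)) (inl (inr f)) = (z - 2) *+ (e == f).
Proof.
rewrite /L /sl_entry degree_subdivision (inj_eq (@inl_inj _ _)) (inj_eq (@inr_inj _ _)).
by rewrite /= addr0 -mulrnBl.
Qed.

Lemma corona_entry_subdiv_l e x :
  L (inl (inr e)) (inl (inl x)) = - (x \in val e)%:R.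
Proof. by rewrite /L /sl_entry /= !mulr0n !add0r. Qed.

Lemma corona_entry_subdiv_r e x :
  L (inl (inl x)) (inl (inr e)) = - (x \in val e)%:R.
Proof. by rewrite /L /sl_entry /= !mulr0n !add0r. Qed.

Lemma corona_entry_base x y :
  L (inl (inl x)) (inl (inl y)) =
  (z - (#|G| - 1 + #|H|)%:R) *+ (x == y) - ((x != y) && ~~ adj x y)%:R.
Proof.
rewrite /L /sl_entry degree_base !(inj_eq (@inl_inj _ _)) /=.
by rewrite mulrnBl opprD addrA.
Qed.

End CoronaEntries.

(** The copies of [H] are eliminated first: the block of [z - Q(K)] on a copy
    has constant row sums, so the elimination only alters the diagonal entries
    of the base vertices. The subdivision vertices are eliminated next, which
    adds a multiple of [B B^T = Q(G)] to the base block. What remains is a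
    combination of the identity, [Q(G)] and the all-ones matrix. *)
Lemma char_poly_corona (C : numClosedFieldType) (G H : sgraph) n m k r s z :
    let d : C := (n - 1 + k)%:R in
    let c := (z - 1 - (2 * s)%:R)^-1 in
    let a := z - d - c * k%:R + 1 - r%:R in
    let b : C := 1 - (z - 2)^-1 in
    #|G| = n -> #|edge G| = m -> #|H| = k ->
    (forall x : G, degree x = r) -> (forall x : H, degree x = s) ->
    z - 2 != 0 -> z - 1 - (2 * s)%:R != 0 -> b != 0 -> a + b * (2 * r)%:R != 0 ->
  (char_poly (signless_laplacian C (central_vertex_corona G H))).[z] =
  (char_poly (signless_laplacian C H)).[z - 1] ^+ n * ((z - 2) ^+ m *
   ((- b) ^+ n * (char_poly (signless_laplacian C G)).[- a / b] *
    \det (1%:M - const_mx (a + b * (2 * r)%:R)^-1 : 'M[C]_n))).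
Proof.
move=> d c a b Gn Em Hk dG dH z2 zs b0 g0.
rewrite horner_char_poly_sl.
pose X (u : G * H) (t : G + edge G) : C := - c * (t == inl u.1)%:R.
rewrite (@detf_schur _ (G + edge G)%type (G * H)%type _ X); last first.
  move=> [x h] t; rewrite corona_entry_copy_l sum_pairs /=.
  under eq_bigr => y _ do under eq_bigr => g _ do
    rewrite (corona_entry_copy _ dH) /X mulrnAl /=.
  rewrite (bigD1 x) //= [X in _ + X]big1 ?addr0; last first.
    by move=> y; rewrite eq_sym => /negbTE->; rewrite big1.
  under eq_bigr => g _ do rewrite eqxx mulr1n.
  rewrite -!mulr_suml sumrB sum_sl_entry dH.
  rewrite (bigD1 h) //= eqxx big1 ?addr0; last first.
    by move=> g; rewrite eq_sym => /negbTE->.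
  by rewrite mulr1n /c mulrA mulrN mulfV // mulN1r.
congr (_ * _).
  rewrite horner_char_poly_sl -Gn -detf_copies; apply: eq_detf => -[x h] [y g].
  exact: corona_entry_copy.
pose Y (e : edge G) (x : G) : C := - (z - 2)^-1 * (x \in val e)%:R.
rewrite (@detf_schur _ G (edge G) _ Y); last first.
  move=> e x; rewrite corona_entry_subdiv_l.
  rewrite [X in _ - X]big1 ?subr0; last first.
    by move=> [y h] _; rewrite corona_entry_copy_r /= oppr0 mul0r.
  under eq_bigr => f _.
    rewrite corona_entry_subdiv big1 ?subr0; last first.
      by move=> [y h] _; rewrite corona_entry_copy_r /= oppr0 mul0r.
    rewrite -(mulr_natl (z - 2)) -mulrA.
    over.
  by rewrite sum_delta /Y mulrA mulrN mulfV // mulN1r.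
congr (_ * _).
  rewrite -Em -detf_scalar; apply: eq_detf => e f; rewrite corona_entry_subdiv.
  by rewrite big1 ?subr0 // => -[y h] _; rewrite corona_entry_copy_r /= oppr0 mul0r.
rewrite -Gn -(det_sub_ones _ b0 g0); last first.
  move=> i; rewrite -(dG (enum_val i)) -sum_sl_entry.
  rewrite [RHS](reindex (fun k : 'I_#|G| => enum_val k)) /=;
    last exact/onW_bij/enum_val_bij.
  by apply: eq_bigr => j _; rewrite signless_laplacianE.
congr (\det _); apply/matrixP => i j.
rewrite !mxE -[in RHS](inj_eq enum_val_inj).
move: (enum_val i) (enum_val j) => x y.
rewrite corona_entry_base Gn Hk -/d.
have -> : \sum_v (z *+ (inl (inl x) == inr v :> central_vertex_corona G H) -
    sl_entry C (inl (inl x) : central_vertex_corona G H) (inr v)) * X v (inl y) =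
    c * k%:R * (x == y)%:R.
  rewrite sum_pairs -(sum_delta x (fun x' => c * k%:R * (x' == y)%:R)).
  apply: eq_bigr => x' _.
  under eq_bigr => h _ do
    rewrite corona_entry_copy_r /X /= !(inj_eq (@inl_inj _ _)).
  by rewrite sumr_const Hk -mulr_natr (eq_sym y); ring.
have -> : \sum_e (z *+ (inl (inl x) == inl (inr e) :> central_vertex_corona G H) -
    sl_entry C (inl (inl x) : central_vertex_corona G H) (inl (inr e)) -
    \sum_v (z *+ (inl (inl x) == inr v :> central_vertex_corona G H) -
      sl_entry C (inl (inl x) : central_vertex_corona G H) (inr v)) * X v (inr e)) * Y e y =
    (z - 2)^-1 * sl_entry C x y.
  rewrite -sum_incidence mulr_sumr; apply: eq_bigr => e _.
  rewrite corona_entry_subdiv_r big1 ?subr0; last first.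
    by move=> v _; rewrite /X /= mulr0 mulr0.
  by rewrite /Y; ring.
rewrite /sl_entry dG /a /b; move: (z - 2)^-1 => w; have [->|xy] /= := eqVneq x y.
  by rewrite adj_irr /= !mulr1n; ring.
by case: (adj x y); rewrite /= ?mulr0n ?mulr1n; ring.
Qed.

Lemma char_poly_corona_eq (C : numClosedFieldType) (G1 G2 H1 H2 : sgraph) r s :
    (0 < #|H1|)%N -> #|G1| = #|G2| -> #|H1| = #|H2| ->
    (forall x : G1, degree x = r) -> (forall x : G2, degree x = r) ->
    (forall x : H1, degree x = s) -> (forall x : H2, degree x = s) ->
    char_poly (signless_laplacian C G1) = char_poly (signless_laplacian C G2) ->
    char_poly (signless_laplacian C H1) = char_poly (signless_laplacian C H2) ->
  char_poly (signless_laplacian C (central_vertex_corona G1 H1)) =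
  char_poly (signless_laplacian C (central_vertex_corona G2 H2)).
Proof.
move=> H_gt0 G12 H12 dG1 dG2 dH1 dH2 pG pH.
have E12 : #|edge G1| = #|edge G2|.
  apply/eqP; rewrite -(eqn_pmul2l (isT : (0 < 2)%N)) -!handshake.
  rewrite (eq_bigr _ (fun x _ => dG1 x)) (eq_bigr _ (fun x _ => dG2 x)).
  by rewrite !sum_nat_const G12.
pose k := #|H1|; pose d : C := (#|G1| - 1 + k)%:R.
pose t : C := 1 + (2 * s)%:R.
(* Up to the denominators [z - 2] and [z - t], the value of [q] at [z] is the
   constant row sum of [a + b Q(G)] in the reduced base block. *)
pose q : {poly C} := ('X - 2%:P) * ('X - t%:P) * ('X - (d - 1 - r%:R)%:P)
  - k%:R%:P * ('X - 2%:P) - (2 * r)%:R%:P * ('X - t%:P).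
have qE x : q.[x] = (x - 2) * (x - t) * (x - (d - 1 - r%:R))
    - k%:R * (x - 2) - (2 * r)%:R * (x - t) by rewrite /q !hornerE.
have q0 : q != 0.
  (* At [t] only the middle term survives; it is nonzero as [t] is odd. *)
  apply/eqP => /(congr1 (fun p => p.[t])).
  rewrite qE horner0 subrr mulr0 mul0r mulr0 subr0 sub0r => /eqP.
  rewrite oppr_eq0 mulf_eq0 pnatr_eq0 eqn0Ngt H_gt0 /= subr_eq0 /t.
  rewrite -(natrD _ 1%N) eqr_nat; lia.
apply: (@poly_eq_off _ _ _ (('X - 2%:P) * ('X - 3%:P) * ('X - t%:P) * q)).
  by rewrite !mulf_neq0 ?polyXsubC_eq0.
move=> z; rewrite !hornerM !hornerXsubC !mulf_eq0 !negb_or.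
move=> /andP[/andP[/andP[z2 z3] zt] qz].
have zs : z - 1 - (2 * s)%:R != 0 by rewrite -addrA -opprD.
have b0 : 1 - (z - 2)^-1 != 0.
  apply: contra z3 => /eqP b0; apply/eqP.
  by transitivity ((1 - (z - 2)^-1) * (z - 2)); [field | rewrite b0 mul0r].
have g0 : z - d - (z - 1 - (2 * s)%:R)^-1 * k%:R + 1 - r%:R
    + (1 - (z - 2)^-1) * (2 * r)%:R != 0.
  apply: contra qz => /eqP g0; apply/eqP.
  have -> : q.[z] = (z - d - (z - 1 - (2 * s)%:R)^-1 * k%:R + 1 - r%:R
    + (1 - (z - 2)^-1) * (2 * r)%:R) * ((z - 2) * (z - 1 - (2 * s)%:R)).
    rewrite qE /t !natrM; field.
    by rewrite z2 -natrM zs.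
  by rewrite g0 mul0r.
rewrite (char_poly_corona erefl erefl erefl dG1 dH1) //.
rewrite (char_poly_corona (esym G12) (esym E12) (esym H12) dG2 dH2) //.
by rewrite pG pH.
Qed.

(** The signless Laplacian spectrum determines the order of a graph, as the
    degree of the characteristic polynomial, and then, through the trace, the
    degree of a regular graph. *)
Lemma cospectral_regular (C : numClosedFieldType) (G1 G2 : sgraph) r1 r2 :
    (0 < #|G1|)%N ->
    (forall x : G1, degree x = r1) -> (forall x : G2, degree x = r2) ->
    (forall a : C, Q_multiplicity G1 a = Q_multiplicity G2 a) ->
  [/\ char_poly (signless_laplacian C G1) = char_poly (signless_laplacian C G2),
      #|G1| = #|G2| & r1 = r2].
Proof.
move=> G1_gt0 d1 d2 mE.
have pE : char_poly (signless_laplacian C G1) = char_poly (signless_laplacian C G2).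
  by apply: monic_eq_of_mup => //; apply: char_poly_monic.
have G12 : #|G1| = #|G2|.
  by have := size_char_poly (signless_laplacian C G1); rewrite pE size_char_poly => -[].
have trE (G : sgraph) r : (forall x : G, degree x = r) ->
    \tr (signless_laplacian C G) = (#|G| * r)%:R.
  move=> dG; rewrite /mxtrace.
  under eq_bigr => i _ do
    rewrite signless_laplacianE /sl_entry eqxx adj_irr dG addr0 mulr1n.
  by rewrite sumr_const card_ord mulnC mulrnA.
have G2_gt0 : (0 < #|G2|)%N by rewrite -G12.
have tr12 : \tr (signless_laplacian C G1) = \tr (signless_laplacian C G2).
  apply: oppr_inj; rewrite -(char_poly_trace _ G1_gt0) -(char_poly_trace _ G2_gt0).
  by rewrite pE G12.
split=> //; apply/eqP; rewrite -(eqn_pmul2l G1_gt0) [X in _ == (X * _)%N]G12.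
by rewrite -(eqr_nat C) -(trE _ _ d1) -(trE _ _ d2) tr12.
Qed.

(** * Coronas of cospectral graphs *)

Section Cospectral.
Variables (C : numClosedFieldType) (G1 G2 H1 H2 : sgraph) (r s : nat).
Hypotheses (cG1 : connected_graph G1) (cH1 : connected_graph H1).
Hypotheses (G12 : #|G1| = #|G2|) (H12 : #|H1| = #|H2|).
Hypotheses (dG1 : forall x : G1, degree x = r) (dG2 : forall x : G2, degree x = r).
Hypotheses (dH1 : forall x : H1, degree x = s) (dH2 : forall x : H2, degree x = s).

Lemma corona_nonisomorphic : ~ isomorphic G1 G2 \/ ~ isomorphic H1 H2 ->
  ~ isomorphic (central_vertex_corona G1 H1) (central_vertex_corona G2 H2).
Proof.
have [[G_gt0 _] [H_gt0 _]] := (cG1, cH1).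
have [a _] := card_gt0P H_gt0.
have sH : (s < #|H1|)%N by rewrite -(dH1 a) degree_lt_order.
move=> nI iso.
have [nG nH] : (#|G1| - 1 + #|H1| != 2)%N /\ (#|G1| - 1 + #|H1| != s.+1)%N.
  case: nI => nI.
    by have [] := noniso_regular cG1 G12 dG1 dG2 nI; lia.
  by have [] := noniso_regular cH1 H12 dH1 dH2 nI; lia.
by have [] := corona_isomorphic G_gt0 G12 H12 dH1 dH2 nG nH iso; case: nI.
Qed.

Lemma corona_cospectral :
    ~ isomorphic G1 G2 \/ ~ isomorphic H1 H2 ->
    char_poly (signless_laplacian C G1) = char_poly (signless_laplacian C G2) ->
    char_poly (signless_laplacian C H1) = char_poly (signless_laplacian C H2) ->
  Q_cospectral C (central_vertex_corona G1 H1) (central_vertex_corona G2 H2).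
Proof.
move=> nI pG pH; split; first exact: corona_nonisomorphic.
move=> z; rewrite /Q_multiplicity; congr mup.
by have [H_gt0 _] := cH1; apply: char_poly_corona_eq dG1 dG2 dH1 dH2 pG pH.
Qed.

End Cospectral.

Theorem corollary3p14 (C : numClosedFieldType) :
  (forall G1 G2 H : sgraph,
     connected_graph G1 -> connected_graph G2 -> connected_graph H ->
     regular_graph G1 -> regular_graph G2 -> regular_graph H ->
     Q_cospectral C G1 G2 ->
     Q_cospectral C (central_vertex_corona H G1) (central_vertex_corona H G2))
  /\
  (forall G1 G2 H : sgraph,
     connected_graph G1 -> connected_graph G2 -> connected_graph H ->
     regular_graph G1 -> regular_graph G2 -> regular_graph H ->
     Q_cospectral C G1 G2 ->
     Q_cospectral C (central_vertex_corona G1 H) (central_vertex_corona G2 H))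
  /\
  (forall G1 G2 H1 H2 : sgraph,
     connected_graph G1 -> connected_graph G2 ->
     connected_graph H1 -> connected_graph H2 ->
     regular_graph G1 -> regular_graph G2 ->
     regular_graph H1 -> regular_graph H2 ->
     Q_cospectral C G1 G2 -> Q_cospectral C H1 H2 ->
     Q_cospectral C (central_vertex_corona G1 H1)
                    (central_vertex_corona G2 H2)).
Proof.
split; [|split].
- move=> G1 G2 H cG1 cG2 cH [r d1] [r2 d2] [s dH] [nI mE].
  have [pE G12 rE] := cospectral_regular (proj1 cG1) d1 d2 mE; subst r2.
  by apply: (corona_cospectral cH cG1 erefl G12 dH dH d1 d2) => //; right.
- move=> G1 G2 H cG1 cG2 cH [r d1] [r2 d2] [s dH] [nI mE].
  have [pE G12 rE] := cospectral_regular (proj1 cG1) d1 d2 mE; subst r2.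
  by apply: (corona_cospectral cG1 cH G12 erefl d1 d2 dH dH) => //; left.
- move=> G1 G2 H1 H2 cG1 cG2 cH1 cH2 [r d1] [r2 d2] [s e1] [s2 e2] [nI mE] [_ mF].
  have [pG G12 rE] := cospectral_regular (proj1 cG1) d1 d2 mE; subst r2.
  have [pH H12 sE] := cospectral_regular (proj1 cH1) e1 e2 mF; subst s2.
  by apply: (corona_cospectral cG1 cH1 G12 H12 d1 d2 e1 e2) => //; left.
Qed.
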